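(* Let $A$ be an $n\times n$ Hermitian matrix with eigenvalues in $(-1,1)$, let $\sigma>0$, $\mu\in\mathbb{R}$, $\alpha>0$, $\tilde\tau\ge 0$, let $m\ge 1$ be an integer, and set $$\rho=(1+\alpha\sigma)^{-1},\qquad K=\frac{2}{\rho\alpha\sigma}e^{\alpha^2}.$$ Let the vertex set $\{1,\dots,n\}$ of the graph induced by $A$ be partitioned into $M$ disjoint elements $\{E_\kappa\}_{\kappa=1}^M$. For each $\kappa$, let $Q_\kappa$ be the extended element, $A_\kappa$ the submatrix, and $U_\kappa,V_\kappa$ the matrices (with truncation tolerance $\tilde\tau$) defined in the context, and let $\tilde f$ be the $n\times n$ matrix defined by $$\tilde f_{ij}=\begin{cases}(U_\kappa)_{i,:}(V_\kappa)_{:,j}, & i\in Q_\kappa,\ j\in E_\kappa \text{ for some } \kappa,\\ 0,& i\notin Q_\kappa,\ j\in E_\kappa.\end{cases}$$ Then $$\|f_{\sigma,\mu}(A)-\tilde f\|_{\max}\le 2K\rho^{\frac m2+1}+\tilde\tau.$$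
   Context: $f_{\sigma,\mu}(z)=e^{-\frac{(z-\mu)^2}{\sigma^2}}$, and $f_{\sigma,\mu}(A)$ is the corresponding matrix function of a Hermitian matrix (via its eigen-decomposition). $\|A\|_{\max}=\max_{i,j}|A_{ij}|$ and $\|\cdot\|_2$ is the matrix $2$-norm. $A_{i,:}$ and $A_{:,j}$ denote the $i$-th row and the $j$-th column, and $A_{\mathcal I,:}$ denotes the rows with indices in $\mathcal I$. Graph and distance: $A$ induces an undirected graph with vertices $\{1,\dots,n\}$ and edges $\{(i,j):A_{ij}\ne0\}$; $d(i,j)$ is the geodesic distance, i.e. the smallest number of edges in a path linking $i$ and $j$, with $d(i,i)=0$ and $d(i,j)=\infty$ if $i\neq j$ and there is no path. Extended element: $Q_\kappa=\{i : d(i,j)\le m \text{ for some } j\in E_\kappa\}$ (so $E_\kappa\subseteq Q_\kappa$). Submatrix: $A_\kappa$ is the $n\times n$ matrix with $(A_\kappa)_{ij}=A_{ij}$ if $i,j\in Q_\kappa$ and $(A_\kappa)_{ij}=0$ otherwise. Local eigen-decomposition: $A_\kappa X_\kappa=X_\kappa D_\kappa$, where $D_\kappa$ is a real diagonal matrix of size $|Q_\kappa|\times|Q_\kappa|$ and $X_\kappa$ is an $n\times|Q_\kappa|$ matrix with orthonormal columns whose entries in rows outside $Q_\kappa$ are zero (equivalently, the eigen-decomposition of the $|Q_\kappa|\times|Q_\kappa|$ principal submatrix of $A$ on $Q_\kappa$, with the eigenvectors extended by zero). Local truncated SVD: $\tilde U_\kappa,\tilde S_\kappa,\tilde V_\kappa$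 form a truncated singular value decomposition ($\tilde U_\kappa,\tilde V_\kappa$ with orthonormal columns, $\tilde S_\kappa$ diagonal with nonnegative entries) such that $$\big\|f_{\sigma,\mu}(D_\kappa)\,((X_\kappa)_{Q_\kappa,:})^*-\tilde U_\kappa\tilde S_\kappa\tilde V_\kappa^*\big\|_2\le\tilde\tau .$$ Then $U_\kappa=X_\kappa\tilde U_\kappa$ and $V_\kappa=\tilde S_\kappa\tilde V_\kappa^*$; the columns of $V_\kappa$ are indexed by $Q_\kappa$. *)

(* Defs.v *)
From HB Require Import structures.
From mathcomp Require Import all_boot all_order all_algebra spectral sesquilinear.
From mathcomp Require Import complex.
From mathcomp Require Import all_classical all_reals all_analysis.

Set Implicit Arguments.
Unset Strict Implicit.
Unset Printing Implicit Defensive.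
Import Order.TTheory GRing.Theory Num.Theory.

Local Open Scope ring_scope.
Local Open Scope complex_scope.
Local Open Scope sesquilinear_scope.

Section Norms.
Variable R : realType.

Definition vec_norm2 (n : nat) (x : 'cV[R[i]]_n) : R :=
  Num.sqrt (\sum_(i < n) Normc.normc (x i 0) ^+ 2).

(* The unit ball, rather than the unit sphere, keeps the set nonempty when
   n = 0. *)
Definition mx_norm2 (m n : nat) (B : 'M[R[i]]_(m, n)) : R :=
  sup [set vec_norm2 (B *m x) | x in [set x | vec_norm2 x <= 1]]%classic.

End Norms.

Section MatrixFunctions.
Variable R : realType.

Definition gauss (sigma mu z : R) : R :=
  expR (- ((z - mu) ^+ 2 / sigma ^+ 2)).

(* For Hermitian B, B = invmx P *m diag_mx d *m P where P = spectralmx B is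
   unitary and d = spectral_diag B is real, so that taking real parts of the
   eigenvalues loses nothing. *)
Definition hermitian_fun (f : R -> R) (n : nat) (B : 'M[R[i]]_n) : 'M[R[i]]_n :=
  invmx (spectralmx B)
    *m diag_mx (map_mx (fun z : R[i] => (f (complex.Re z))%:C) (spectral_diag B))
    *m spectralmx B.

Definition real_diag (n : nat) (d : 'rV[R]_n) : 'M[R[i]]_n :=
  diag_mx (map_mx (fun x : R => x%:C) d).

End MatrixFunctions.

Section Graph.
Variables (R : realType) (n : nat) (A : 'M[R[i]]_n).

Definition edge : rel 'I_n := fun i j => A i j != 0.

Definition walk (i j : 'I_n) (k : nat) : bool :=
  [exists p : k.-tuple 'I_n, path edge i p && (last i p == j)].

Definition gdist (i j : 'I_n) : \bar int :=
  if pselect (exists k, walk i j k) is left ex_walk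
  then (Posz (ex_minn ex_walk))%:E else +oo%E.

Definition ext_element (m : nat) (E : {set 'I_n}) : {set 'I_n} :=
  [set i | [exists j in E, (gdist i j <= (Posz m)%:E)%E]].

Definition submx_on (Q : {set 'I_n}) : 'M[R[i]]_n :=
  \matrix_(i, j) if (i \in Q) && (j \in Q) then A i j else 0.

End Graph.

(* Below, the indices of a set Q : {set 'I_n} are numbered by 'I_#|Q| through
   enum_val and enum_rank_in. *)
Section Local.
Variables (R : realType) (n : nat).

Definition orthonormal_cols (m p : nat) (X : 'M[R[i]]_(m, p)) : Prop :=
  X^t* *m X = 1%:M.

Definition local_eigen (A : 'M[R[i]]_n) (Q : {set 'I_n})
    (X : 'M[R[i]]_(n, #|Q|)) (d : 'rV[R]_#|Q|) : Prop :=
  [/\ submx_on A Q *m X = X *m real_diag d,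
      orthonormal_cols X
    & forall i a, i \notin Q -> X i a = 0].

Definition rows_on (Q : {set 'I_n}) (p : nat) (X : 'M[R[i]]_(n, p)) :
  'M[R[i]]_(#|Q|, p) := rowsub (@enum_val _ (mem Q)) X.

(* A singular value decomposition Ut *m real_diag s *m Vt^t* of some matrix of
   rank at most r that approximates B up to tau; the best rank r approximation
   obtained by truncating an SVD of B is an instance. *)
Definition truncated_svd (p q r : nat) (tau : R) (B : 'M[R[i]]_(p, q))
    (Ut : 'M[R[i]]_(p, r)) (s : 'rV[R]_r) (Vt : 'M[R[i]]_(q, r)) : Prop :=
  [/\ orthonormal_cols Ut, orthonormal_cols Vt, forall l, 0 <= s 0 l
    & mx_norm2 (B - Ut *m real_diag s *m Vt^t*) <= tau].

(* The column of V numbered by j \in Q; 0 is a dummy value. *)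
Definition col_on (Q : {set 'I_n}) (r : nat) (V : 'M[R[i]]_(r, #|Q|))
    (j : 'I_n) : 'cV[R[i]]_r :=
  if @idP (j \in Q) is ReflectT jQ then col (enum_rank_in jQ j) V else 0.

(* The elements E k partition the indices, so at most one k is picked. *)
Definition assemble (M : nat) (E Q : 'I_M -> {set 'I_n}) (r : 'I_M -> nat)
    (U : forall k, 'M[R[i]]_(n, r k)) (V : forall k, 'M[R[i]]_(r k, #|Q k|)) :
    'M[R[i]]_n :=
  \matrix_(i, j)
    if [pick k | (i \in Q k) && (j \in E k)] is Some k
    then (row i (U k) *m col_on (V k) j) 0 0 else 0.

End Local.

(* Main.v *)
Require Import Defs.
From HB Require Import structures.
From mathcomp Require Import all_boot all_order all_algebra spectral sesquilinear.
From mathcomp Require Import complex.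
From mathcomp Require Import all_classical all_reals all_analysis.
From mathcomp Require Import cyclic separable cyclotomic ring lra.

(** Every entry of the error is controlled by how well the Gaussian [f] is
    approximated on [-1, 1] by a polynomial [q] of degree at most [m].

    Graph side.  The entry (i, j) of [A ^+ k] is a sum over walks of length [k]
    from [i] to [j].  When [j] lies in an element [E] and [k <= m], all these
    walks stay in the extended element [Q], so [q(A)] and [q] of the submatrix
    on [Q] have the same columns with index in [E], and these columns vanish
    outside [Q] ([mx_poly_submx_on], [mx_poly_outside]).  If [f] and [q] differ
    by at most [e] on [-1, 1], then so do [f] and [q] of a Hermitian matrix with
    spectrum in [-1, 1], entry by entry, because the rows of the eigenvector
    matrix have norm at most 1 ([entry_diag_perturb]).  The local eigenvalues
    are Rayleigh quotients of [A], hence are also in [-1, 1]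
    ([local_eigenvalue_bound]).  Thus an entry outside [Q] costs [e], an entry
    inside costs [2 e], one for [A] and one for the submatrix, and the truncated
    decomposition adds [tau] ([truncated_entry_error]).

    Approximation side.  A polynomial bounded by [M] on the ellipse with foci
    -1 and 1 that is the image of the circle of radius [chi] under
    [w |-> (w + 1 / w) / 2] has Chebyshev coefficients at most
    [2 M / chi ^+ k], and cutting its Chebyshev expansion after degree [m]
    leaves an error at most [2 M / ((chi - 1) chi ^+ m)]
    ([bernstein_approx]).  A coefficient is a discrete Fourier
    coefficient over enough roots of unity, so no contour integral is involved.
    For [chi = 1 + alpha sigma] the ellipse has height at most
    [alpha sigma], which bounds the Gaussian on it by [exp (alpha ^+ 2)].
    Rather than to the Gaussian, the result is applied to the polynomials
    [(1 - ((z - mu) / sigma) ^+ 2 / N) ^+ N], which tend to it as [N] grows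
    and satisfy the same bound in the limit ([gauss_approx]).

    This gives [e = K rho ^+ m.+1] up to an arbitrarily small term, and
    [rho ^+ m.+1] is at most [rho `^ (m / 2 + 1)] since [rho <= 1]. *)

Set Implicit Arguments.
Unset Strict Implicit.
Unset Printing Implicit Defensive.
Import Order.TTheory GRing.Theory Num.Theory.

Local Open Scope ring_scope.
Local Open Scope complex_scope.
Local Open Scope sesquilinear_scope.

(** * Chebyshev expansions and Bernstein's approximation theorem *)

Section Chebyshev.
Variable C : numClosedFieldType.
Implicit Types (w x : C) (p : {poly C}).

Definition joukowski w : C := (w + w^-1) / 2.

(** The Chebyshev polynomials of the first kind. *)
Fixpoint cheb (k : nat) : {poly C} :=
  match k with
  | 0 => 1
  | k'.+1 => match k' with
             | 0 => 'X
             | k''.+1 => 2%:P * ('X * cheb k') - cheb k''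
             end
  end.

Lemma chebSS k : cheb k.+2 = 2%:P * ('X * cheb k.+1) - cheb k.
Proof. by []. Qed.

(** The functional equation cos (k t) = T_k (cos t), with [w] in the role of
    exp (i t); it makes Chebyshev expansions Laurent expansions in [w]. *)
Lemma cheb_joukowski w k :
  w != 0 -> (cheb k).[joukowski w] = joukowski (w ^+ k).
Proof.
move=> w0; have [] : (cheb k).[joukowski w] = joukowski (w ^+ k) /\
  (cheb k.+1).[joukowski w] = joukowski (w ^+ k.+1); last by [].
elim: k => [|k [IHk IHk1]].
  by rewrite /= !hornerE /joukowski expr0 invr1 expr1; split=> //; field.
split=> //; rewrite chebSS !(hornerD, hornerN, hornerM, hornerC, hornerX) IHk IHk1.
rewrite /joukowski !exprS.
have wk0 : w ^+ k != 0 by rewrite expf_neq0.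
by field; rewrite w0 wk0.
Qed.

Lemma size_cheb k : (size (cheb k) <= k.+1)%N.
Proof.
have [] : (size (cheb k) <= k.+1)%N /\ (size (cheb k.+1) <= k.+2)%N; last by [].
elim: k => [|k [IHk IHk1]]; first by rewrite /= size_polyX size_poly1.
split=> //; rewrite chebSS (leq_trans (size_polyD _ _)) // geq_max size_polyN.
rewrite (leqW (leqW IHk)) andbT mul_polyC.
rewrite (leq_trans (size_scale_leq _ _)) //.
by rewrite (leq_trans (size_polyMleq _ _)) // size_polyX.
Qed.

Lemma cheb_lead_neq0 k : (cheb k)`_k != 0.
Proof.
case: k => [|k]; first by rewrite coefC oner_eq0.
elim: k => [|k IHk]; first by rewrite coefX oner_eq0.
rewrite chebSS coefB mul_polyC coefZ coefXM /= [X in _ - X]nth_default.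
  by rewrite subr0 mulf_neq0 // pnatr_eq0.
by rewrite (leq_trans (size_cheb k)).
Qed.

(** [cheb k] has degree exactly [k], so the leading terms can be peeled off one
    at a time. *)
Lemma cheb_expansion N p : (size p <= N)%N ->
  exists b : nat -> C, p = \sum_(k < N) b k *: cheb k.
Proof.
elim: N p => [|N IHN] p; first rewrite leqn0 size_poly_eq0 => /eqP ->.
  by exists (fun=> 0); rewrite big_ord0.
move=> sp; pose c := p`_N / (cheb N)`_N.
have [|b pE] := IHN (p - c *: cheb N).
  apply/leq_sizeP => j; rewrite leq_eqVlt => /predU1P[<-|Nj].
    by rewrite coefB coefZ /c divfK ?cheb_lead_neq0 ?subrr.
  rewrite coefB coefZ !nth_default ?mulr0 ?subr0 //; last exact: leq_trans Nj.
  exact: leq_trans (size_cheb _) Nj.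
exists (fun k => if (k < N)%N then b k else c).
rewrite big_ord_recr /= ltnn -[LHS](subrK (c *: cheb N)) pE; congr (_ + _).
by apply: eq_bigr => i _; rewrite ltn_ord.
Qed.

(** A real [x] in [-1, 1] is the image of a point of the unit circle. *)
Lemma cheb_norm_le1 k x : -1 <= x <= 1 -> `|(cheb k).[x]| <= 1.
Proof.
move=> /andP[x1 x2]; pose y := sqrtC (1 - x ^+ 2); pose w := x + 'i * y.
have xr : x \is Num.real by rewrite (ler_real x2) real1.
have y0 : 0 <= 1 - x ^+ 2.
  by rewrite -(expr1n _ 2) subr_sqr mulr_ge0 ?subr_ge0 // -lerBlDl sub0r.
have yr : y \is Num.real by rewrite ger0_real // sqrtC_ge0.
have w1 : `|w| = 1.
  apply/eqP; rewrite -sqrp_eq1 // normC2_rect // sqrtCK.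
  by rewrite addrC subrK.
have w0 : w != 0 by rewrite -normr_eq0 w1 oner_eq0.
have -> : x = joukowski w.
  rewrite /joukowski invC_norm w1 expr1n invr1 mul1r conjC_rect //.
  by rewrite /w; field.
rewrite cheb_joukowski // /joukowski normrM normfV normr_nat.
rewrite ler_pdivrMr ?ltr0n // mul1r (le_trans (ler_normD _ _)) //.
by rewrite normfV normrX w1 expr1n invr1.
Qed.

Lemma prim_root_existsC n : (0 < n)%N -> exists z : C, n.-primitive_root z.
Proof.
move=> n0; have [rs] := closed_field_poly_normal ('X^n - 1 : {poly C}).
rewrite (monicP (monicXnsubC _ n0)) scale1r => rsE.
have rs1 : all n.-unity_root rs.
  by apply/allP => z zrs; rewrite /root_of_unity rsE root_prod_XsubC.
have rsU : uniq rs.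
  by rewrite -separable_prod_XsubC -rsE separable_Xn_sub_1 // pnatr_eq0 -lt0n.
have rsn : (n <= size rs)%N.
  by rewrite -ltnS -(size_prod_XsubC rs id) -rsE size_XnsubC.
by have /hasP[z _ zP] := has_prim_root n0 rs1 rsU rsn; exists z.
Qed.

Lemma sum_unity_root n (z : C) :
  z ^+ n = 1 -> \sum_(j < n) z ^+ j = if z == 1 then n%:R else 0.
Proof.
case: eqVneq => [-> _|z1 zn].
  by rewrite (eq_bigr (fun=> 1)) ?sumr_const ?card_ord // => i _; rewrite expr1n.
apply/eqP; rewrite -(mulrI_eq0 _ (mulfI (x := z - 1) _)) ?subr_eq0 //.
by rewrite -subrX1 zn subrr.
Qed.

(** Along the circle of radius [chi], [p] composed with the map [joukowski] is
    the Laurent polynomial with coefficients [b l / 2] at [w ^+ l] and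
    [w ^- l].  Averaging it against the [k]-th power over the [2 N]-th roots of
    unity isolates [b k * chi ^+ k / 2], since all the exponents that occur are
    distinct modulo [2 N]. *)
Lemma cheb_coef_bound N (b : nat -> C) (chi M : C) p k :
  0 < chi -> p = \sum_(l < N) b l *: cheb l ->
  (forall w, `|w| = chi -> `|p.[joukowski w]| <= M) ->
  (0 < k < N)%N -> `|b k| <= 2 * M / chi ^+ k.
Proof.
move=> chi0 pE pM /andP[k0 kN].
have n0 : (0 < 2 * N)%N by rewrite mul2n double_gt0 (leq_trans _ kN).
have [z zP] := prim_root_existsC n0.
set n := (2 * N)%N in n0 zP.
have zn : z ^+ n = 1 by apply: prim_expr_order.
have z1 : `|z| = 1 by apply/eqP; rewrite -(pexpr_eq1 n0) // -normrX zn normr1.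
have z0 : z != 0 by rewrite -normr_eq0 z1 oner_eq0.
have chin0 : chi != 0 by rewrite gt_eqF.
pose S := \sum_(j < n) p.[joukowski (chi * z ^+ j)] / z ^+ (j * k).
have SE : S = n%:R * (b k * chi ^+ k / 2).
  transitivity (\sum_(l < N) b l / 2 *
    \sum_(j < n) (chi ^+ l * (z ^+ l / z ^+ k) ^+ j +
                 chi ^- l * (z ^+ l * z ^+ k)^-1 ^+ j)).
    under [RHS]eq_bigr do rewrite mulr_sumr.
    rewrite exchange_big; apply: eq_bigr => j _ /=.
    rewrite pE horner_sum mulr_suml; apply: eq_bigr => l _.
    have wj0 : chi * z ^+ j != 0 by rewrite mulf_neq0 // expf_neq0.
    rewrite hornerZ cheb_joukowski // /joukowski.
    have swap i : (z ^+ i) ^+ j = (z ^+ j) ^+ i by rewrite -!exprM mulnC.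
    rewrite exprM expr_div_n exprVn !exprMn !swap.
    by field; rewrite !expf_neq0.
  have zX i : (z ^+ i) ^+ n = 1 by rewrite -exprM mulnC exprM zn expr1n.
  have uq l : (z ^+ l / z ^+ k) ^+ n = 1 by rewrite expr_div_n !zX divr1.
  have up l : (z ^+ l * z ^+ k)^-1 ^+ n = 1.
    by rewrite exprVn exprMn !zX mulr1 invr1.
  have up1 l : (l < N)%N -> ((z ^+ l * z ^+ k)^-1 == 1) = false.
    move=> lN; rewrite invr_eq1 -exprD -(prim_order_dvd zP) gtnNdvd //.
      by rewrite addn_gt0 k0 orbT.
    by rewrite /n mul2n -addnn -addSn leq_add // ltnW.
  rewrite (bigD1 (Ordinal kN)) //= [X in _ + X]big1 => [|l lk].
    rewrite addr0 big_split /= -!mulr_sumr !sum_unity_root //.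
    by rewrite mulfV ?expf_neq0 // eqxx up1 //; field; rewrite expf_neq0.
  rewrite big_split /= -!mulr_sumr !sum_unity_root // up1 //.
  rewrite -(inj_eq (mulIf (expf_neq0 k z0))) divfK ?expf_neq0 // mul1r.
  have n_gt i : (i < N)%N -> (i < n)%N.
    by move=> iN; rewrite /n mul2n -addnn (leq_trans iN) // leq_addr.
  rewrite (eq_prim_root_expr zP) !modn_small ?n_gt // ifN ?mulr0 ?addr0 ?mulr0 //.
have SM : `|S| <= n%:R * M.
  rewrite (le_trans (ler_norm_sum _ _ _)) //.
  rewrite (le_trans (ler_sum _ (G := fun=> M) _)) //; last first.
    by rewrite sumr_const card_ord mulr_natl.
  move=> j _; rewrite normrM normfV normrX z1 expr1n invr1 mulr1 pM //.
  by rewrite normrM normrX z1 expr1n mulr1 gtr0_norm.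
move: SM; rewrite SE normrM normr_nat ler_pM2l ?ltr0n // !normrM normfV normr_nat.
rewrite normrX (gtr0_norm chi0) ler_pdivrMr ?ltr0n //.
by rewrite ler_pdivlMr ?exprn_gt0 // [2 * M]mulrC.
Qed.

(** The polynomial [q] is the Chebyshev expansion of [p] cut after degree [m];
    the coefficients that are dropped form a geometric series of ratio
    [chi^-1]. *)
Theorem bernstein_approx p (chi M : C) m :
  1 < chi -> (forall w, `|w| = chi -> `|p.[joukowski w]| <= M) ->
  exists2 q : {poly C}, (size q <= m.+1)%N &
    forall x, -1 <= x <= 1 -> `|p.[x] - q.[x]| <= 2 * M / ((chi - 1) * chi ^+ m).
Proof.
move=> chi1 pM; pose N := (maxn m.+1 (size p)).
have mN : (m.+1 <= N)%N by rewrite leq_maxl.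
have chi0 : 0 < chi by apply: lt_trans chi1.
have M0 : 0 <= M by rewrite (le_trans _ (pM chi _)) // gtr0_norm.
have [b pE] := cheb_expansion (leq_maxr m.+1 (size p) : (size p <= N)%N).
exists (\sum_(k < m.+1) b k *: cheb k).
  apply/(leq_trans (size_sum _ _ _))/bigmax_leqP => i _.
  by rewrite (leq_trans (size_scale_leq _ _)) // (leq_trans (size_cheb _)).
move=> x x1; rewrite pE !horner_sum.
rewrite -(big_mkord xpredT (fun i => (b i *: cheb i).[x])).
rewrite (big_cat_nat (n := m.+1)) //= big_mkord addrAC subrr add0r.
rewrite (le_trans (ler_norm_sum _ _ _)) //.
have bound k : (m.+1 <= k < N)%N -> `|(b k *: cheb k).[x]| <= 2 * M * chi^-1 ^+ k.
  move=> /andP[mk kN]; rewrite hornerZ normrM exprVn.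
  rewrite -[leRHS]mulr1 ler_pM // ?cheb_norm_le1 //.
  by apply: (cheb_coef_bound chi0 pE) => //; rewrite kN (leq_trans _ mk).
rewrite (le_trans (ler_sum_nat bound)) // -mulr_sumr ler_pM ?mulr_ge0 //.
  by apply: sumr_ge0 => i _; rewrite exprn_ge0 // invr_ge0 ltW.
rewrite -[leRHS]div1r ler_pdivlMr; last by rewrite mulr_gt0 ?subr_gt0 ?exprn_gt0.
have geom : (chi - 1) * (\sum_(m.+1 <= i < N) chi^-1 ^+ i) =
    chi^-1 ^+ m - chi^-1 ^+ N.-1.
  rewrite -(subnKC mN); elim: (N - m.+1)%N => [|l IHl].
    by rewrite addn0 big_geq // mulr0 subrr.
  rewrite addnS big_nat_recr ?leq_addr //= mulrDr IHl addSn /=.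
  rewrite exprS; move: (chi^-1 ^+ (m + l)) => t; field.
  by rewrite gt_eqF.
rewrite mulrA [_ * (chi - 1)]mulrC geom mulrBl exprVn mulVf ?expf_neq0 ?gt_eqF //.
by rewrite gerBl mulr_ge0 // exprn_ge0 ?invr_ge0 ?ltW.
Qed.

End Chebyshev.

(** * Polynomial approximation of the Gaussian *)

Section GaussApproximation.
Variable R : realType.
Implicit Types (x y z c sigma mu : R).

Lemma bernoulli_ineq x N : x <= 1 -> 1 - N%:R * x <= (1 - x) ^+ N.
Proof.
move=> x1; elim: N => [|N IHN]; first by rewrite mul0r subr0 expr0.
have [x0|/ltW x0] := leP 0 x; last first.
  rewrite (@le_trans _ _ (1 - N%:R * x - x)) //.
    by rewrite -natr1; lra.
  rewrite exprS; have := IHN; set t := (1 - x) ^+ N; set s := N%:R * x => st.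
  have : s <= 0 by rewrite /s mulr_ge0_le0.
  by move=> s0; nra.
rewrite exprS -natr1 (@le_trans _ _ ((1 - x) * (1 - N%:R * x))) //; last first.
  by rewrite ler_wpM2l // subr_ge0.
have : 0 <= N%:R * x * x by rewrite !mulr_ge0.
by lra.
Qed.

(** With [t = y / N], the lower bound on the power comes from
    [1 - t >= (1 - t ^+ 2) * expR (- t)], raised to the power [N]. *)
Lemma expR_power_approx y N : (0 < N)%N -> 0 <= y <= N%:R ->
  0 <= expR (- y) - (1 - y / N%:R) ^+ N <= y ^+ 2 / N%:R.
Proof.
move=> N0 /andP[y0 yN]; have N0' : 0 < N%:R :> R by rewrite ltr0n.
have [t tE] : exists t, t = y / N%:R by exists (y / N%:R).
have t0 : 0 <= t by rewrite tE divr_ge0.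
have t1 : t <= 1 by rewrite tE ler_pdivrMr ?mul1r.
have eN : expR (- y) = expR (- t) ^+ N.
  by rewrite -expRM_natl tE; congr expR; field; rewrite gt_eqF.
have u1 : 1 - t <= expR (- t) by exact: expR_ge1Dx.
apply/andP; split.
  by rewrite -tE eN subr_ge0 lerXn2r ?nnegrE ?expR_ge0 ?subr_ge0.
have l1 : (1 - t ^+ 2) * expR (- t) <= 1 - t.
  have -> : 1 - t ^+ 2 = (1 - t) * (1 + t) by ring.
  rewrite -mulrA ler_piMr ?subr_ge0 // expRN ler_pdivrMr ?expR_gt0 // mul1r.
  exact: expR_ge1Dx.
have t21 : t ^+ 2 <= 1 by rewrite expr_le1.
have l2 : expR (- y) * (1 - N%:R * t ^+ 2) <= (1 - t) ^+ N.
  rewrite (@le_trans _ _ (((1 - t ^+ 2) * expR (- t)) ^+ N)) //.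
    by rewrite exprMn -eN mulrC ler_wpM2r ?expR_ge0 // bernoulli_ineq.
  by rewrite lerXn2r ?nnegrE ?mulr_ge0 ?expR_ge0 ?subr_ge0.
have e1 : expR (- y) <= 1 by rewrite expR_le1 oppr_le0.
have -> : y ^+ 2 / N%:R = N%:R * t ^+ 2 by rewrite tE; field; rewrite gt_eqF.
have : 0 <= N%:R * t ^+ 2 by rewrite mulr_ge0 // exprn_ge0.
rewrite -tE; have := expR_ge0 (- y); nra.
Qed.

(** The inequality [1 + h <= expR h] applied to the squared modulus, from which
    a nonpositive term [- 2 * c * (Re z - mu) ^+ 2] is dropped. *)
Lemma norm_quadratic_le_expR mu c (z : R[i]) : 0 <= c ->
  `|1 - c%:C * (z - mu%:C) ^+ 2| <=
  (expR (c * complex.Im z ^+ 2 +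
     c ^+ 2 * ((complex.Re z - mu) ^+ 2 + complex.Im z ^+ 2) ^+ 2 / 2))%:C.
Proof.
case: z => x y c0; rewrite normc_def lecR /=; set e := expR _.
rewrite -[leRHS]ger0_norm ?expR_ge0 // -sqrtr_sqr ler_wsqrtr //.
rewrite /e -expRM_natl expr2 /=.
set h := (X in expR X).
rewrite (@le_trans _ _ (1 + h)) ?expR_ge1Dx //.
have : 0 <= c * (x - mu) ^+ 2 by rewrite mulr_ge0 ?sqr_ge0.
rewrite /h !expr2; lra.
Qed.

(** The image of the circle of radius [chi] is an ellipse with semi-axes
    [(chi + chi^-1) / 2 <= chi] and [(chi - chi^-1) / 2 <= chi - 1]. *)
Lemma joukowski_bounds (chi : R) (w : R[i]) : 1 <= chi -> `|w| = chi%:C ->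
  complex.Im (joukowski w) ^+ 2 <= (chi - 1) ^+ 2 /\
  complex.Re (joukowski w) ^+ 2 + complex.Im (joukowski w) ^+ 2 <= chi ^+ 2.
Proof.
case: w => a b chi1; rewrite normc_def => -[nE]; rewrite /= in nE.
have chi0 : 0 < chi by apply: lt_le_trans chi1.
have n2 : a ^+ 2 + b ^+ 2 = chi ^+ 2.
  by rewrite -nE sqr_sqrtr // addr_ge0 ?sqr_ge0.
set J := joukowski _.
have JE : J = ((a + a / chi ^+ 2) / 2) +i* ((b - b / chi ^+ 2) / 2).
  rewrite /J /joukowski -[2]/((1 + 1)%R).
  apply/eqP; rewrite eq_complex /= n2 !addr0 expr0n /= addr0 mul0r oppr0 !mulr0.
  by rewrite subr0 add0r; apply/andP; split; apply/eqP; field; rewrite gt_eqF.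
rewrite JE /=; have [r rE] : exists r, r = chi^-1 by exists chi^-1.
have r0 : 0 < r by rewrite rE invr_gt0.
have r1 : r <= 1 by rewrite rE invf_le1.
have cr : chi * r = 1 by rewrite rE mulfV ?gt_eqF.
rewrite -!exprVn -rE.
have -> : (a + a * r ^+ 2) / 2 = a * ((1 + r ^+ 2) / 2) by field.
have -> : (b - b * r ^+ 2) / 2 = b * ((1 - r ^+ 2) / 2) by field.
have r20 : 0 <= r ^+ 2 by apply: sqr_ge0.
have r21 : r ^+ 2 <= 1 by rewrite expr_le1 // ltW.
rewrite [(a * _) ^+ 2]exprMn ![(b * _) ^+ 2]exprMn.
split.
  rewrite (@le_trans _ _ (chi ^+ 2 * ((1 - r ^+ 2) / 2) ^+ 2)) //.
    by rewrite ler_wpM2r ?sqr_ge0 // -n2 lerDr sqr_ge0.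
  rewrite -exprMn ler_sqr ?nnegrE ?subr_ge0 //; last first.
    by rewrite mulr_ge0 ?(ltW chi0) // divr_ge0 ?subr_ge0.
  have -> : chi * ((1 - r ^+ 2) / 2) = (chi - chi * r * r) / 2 by field.
  have : 0 <= (chi - 1) * (1 - r) by rewrite mulr_ge0 ?subr_ge0.
  by rewrite cr; lra.
rewrite -n2 lerD // ler_piMr ?sqr_ge0 // expr_le1 //.
- by lra.
- by lra.
- by lra.
- by lra.
Qed.

Lemma expR_le_chord (t : R) : 0 <= t <= 1 / 2 -> expR t <= 1 + 2 * t.
Proof.
move=> /andP[t0 t1]; have t2 : 0 < 1 - t by lra.
have : expR t * (1 - t) <= 1.
  rewrite -[leRHS](expRxMexpNx_1 t) ler_wpM2l ?expR_ge0 //.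
  exact: expR_ge1Dx.
by move=> h; rewrite -(ler_pM2r t2); nra.
Qed.

(** Euler's approximation [(1 + u / N) ^+ N] of the exponential, at
    [u = - ((z - mu) / sigma) ^+ 2]. *)
Definition gauss_poly sigma mu (N : nat) : {poly R[i]} :=
  (1 - ((sigma ^+ 2 * N%:R)^-1)%:C%:P * ('X - mu%:C%:P) ^+ 2) ^+ N.

Lemma norm_real_complex x : `|x%:C| = `|x|%:C :> R[i].
Proof. by rewrite normc_def /= expr0n /= addr0 sqrtr_sqr. Qed.

Lemma horner_gauss_poly sigma mu N (z : R[i]) :
  (gauss_poly sigma mu N).[z] =
  (1 - ((sigma ^+ 2 * N%:R)^-1)%:C * (z - mu%:C) ^+ 2) ^+ N.
Proof.
by rewrite horner_exp !(hornerD, hornerN, hornerM, hornerC, horner_exp, hornerX).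
Qed.

Lemma gauss_poly_real sigma mu N x : 0 < sigma -> (0 < N)%N ->
  (1 + `|mu|) ^+ 2 / sigma ^+ 2 <= N%:R -> -1 <= x <= 1 ->
  `|(gauss sigma mu x)%:C - (gauss_poly sigma mu N).[x%:C]|
    <= (((1 + `|mu|) ^+ 2 / sigma ^+ 2) ^+ 2 / N%:R)%:C.
Proof.
move=> s0 N0 YN x1; set Y := (1 + `|mu|) ^+ 2 / sigma ^+ 2 in YN *.
have N0' : 0 < N%:R :> R by rewrite ltr0n.
pose y := (x - mu) ^+ 2 / sigma ^+ 2.
have y0 : 0 <= y by rewrite divr_ge0 ?sqr_ge0.
have yY : y <= Y.
  rewrite ler_pM2r ?invr_gt0 ?exprn_gt0 // -[leLHS]real_normK ?num_real //.
  rewrite lerXn2r ?nnegrE ?addr_ge0 // (le_trans (ler_normB _ _)) // lerD2r.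
  by rewrite ler_norml.
have /andP[d0 dN] := expR_power_approx N0 (introT andP (conj y0 (le_trans yY YN))).
rewrite horner_gauss_poly.
set c := (sigma ^+ 2 * N%:R)^-1.
have -> : (1 - c%:C * (x%:C - mu%:C) ^+ 2) ^+ N =
    ((1 - c * (x - mu) ^+ 2) ^+ N)%:C :> R[i].
  by rewrite rmorphXn rmorphB rmorph1 rmorphM rmorphXn rmorphB.
rewrite -rmorphB norm_real_complex lecR /c.
have -> : (sigma ^+ 2 * N%:R)^-1 * (x - mu) ^+ 2 = y / N%:R.
  by rewrite /y; field; rewrite !gt_eqF.
rewrite ger0_norm // (le_trans dN) // ler_pM2r ?invr_gt0 //.
by rewrite lerXn2r ?nnegrE // (le_trans y0).
Qed.

(** The first summand of the exponent bounds the real part of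
    [- ((z - mu) / sigma) ^+ 2], which only the imaginary part of [z] makes
    positive; the second one vanishes in the limit. *)
Lemma gauss_poly_ellipse sigma mu chi N (w : R[i]) :
  0 < sigma -> (0 < N)%N -> 1 <= chi -> `|w| = chi%:C ->
  `|(gauss_poly sigma mu N).[joukowski w]|
    <= (expR ((chi - 1) ^+ 2 / sigma ^+ 2 +
              2 * (chi ^+ 2 + mu ^+ 2) ^+ 2 / sigma ^+ 4 / N%:R))%:C.
Proof.
move=> s0 N0 chi1 wE; have [ImJ normJ] := joukowski_bounds chi1 wE.
move: (joukowski w) ImJ normJ => z ImJ normJ.
have N0' : 0 < N%:R :> R by rewrite ltr0n.
set c := (sigma ^+ 2 * N%:R)^-1.
have c0 : 0 <= c by rewrite invr_ge0 mulr_ge0 ?sqr_ge0 ?ltW.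
rewrite horner_gauss_poly normrX -/c.
have le1 := norm_quadratic_le_expR mu z c0.
rewrite (le_trans (lerXn2r _ _ _ le1)) ?nnegrE ?normr_ge0 ?ler0c ?expR_ge0 //.
rewrite -rmorphXn lecR -expRM_natl ler_expR mulrDr.
have Nc : N%:R * c = (sigma ^+ 2)^-1.
  by rewrite /c; field; rewrite !gt_eqF.
have S2 : (complex.Re z - mu) ^+ 2 + complex.Im z ^+ 2 <= 2 * (chi ^+ 2 + mu ^+ 2).
  have := sqr_ge0 (complex.Re z + mu).
  have := sqr_ge0 (complex.Im z).
  move: normJ; rewrite !expr2; lra.
apply: lerD; first by rewrite mulrA Nc mulrC ler_wpM2r // invr_ge0 sqr_ge0.
set S := _ + complex.Im z ^+ 2 in S2 *.
have S0 : 0 <= S by rewrite addr_ge0 ?sqr_ge0.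
have -> : N%:R * (c ^+ 2 * S ^+ 2 / 2) = S ^+ 2 * (c / sigma ^+ 2 / 2).
  by rewrite -Nc; field.
rewrite (@le_trans _ _ ((2 * (chi ^+ 2 + mu ^+ 2)) ^+ 2 * (c / sigma ^+ 2 / 2))) //.
  rewrite ler_wpM2r ?divr_ge0 ?sqr_ge0 // lerXn2r ?nnegrE //.
  exact: le_trans S0 _.
by rewrite /c le_eqVlt; apply/orP; left; apply/eqP; field; rewrite !gt_eqF.
Qed.

(** Half of [eps] absorbs the distance from the Gaussian to [gauss_poly] on
    [-1, 1], the other half the excess over [expR (alpha ^+ 2)] of the bound
    for [gauss_poly] on the ellipse. *)
Theorem gauss_approx sigma mu alpha eps m :
  0 < sigma -> 0 < alpha -> 0 < eps ->
  exists2 q : {poly R[i]}, (size q <= m.+1)%N &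
    forall x, -1 <= x <= 1 -> `|(gauss sigma mu x)%:C - q.[x%:C]| <=
     (2 * expR (alpha ^+ 2) / (alpha * sigma * (1 + alpha * sigma) ^+ m) + eps)%:C.
Proof.
move=> s0 a0 e0; have as0 : 0 < alpha * sigma by rewrite mulr_gt0.
pose chi := 1 + alpha * sigma; have chi1 : 1 < chi by rewrite /chi; lra.
pose G := 2 * expR (alpha ^+ 2) / (alpha * sigma * chi ^+ m).
have G0 : 0 <= G.
  rewrite divr_ge0 // mulr_ge0 ?expR_ge0 ?exprn_ge0 ?(ltW as0) //.
  exact: ltW (lt_trans ltr01 chi1).
pose Y := (1 + `|mu|) ^+ 2 / sigma ^+ 2.
have Y0 : 0 <= Y by rewrite divr_ge0 ?sqr_ge0.
pose B := 2 * (chi ^+ 2 + mu ^+ 2) ^+ 2 / sigma ^+ 4.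
have B0 : 0 <= B.
  rewrite divr_ge0 ?mulr_ge0 ?exprn_ge0 ?addr_ge0 ?sqr_ge0 //; exact: ltW.
(* The terms of L make N large enough for, in turn, N > 0, Y <= N, YYN, t1
   and tG. *)
pose L := 1 + Y + 2 * Y ^+ 2 / eps + 2 * B + 4 * B * G / eps.
have L2 : 0 <= 2 * Y ^+ 2 / eps.
  by rewrite mulr_ge0 ?mulr_ge0 ?invr_ge0 ?sqr_ge0 ?(ltW e0).
have L4 : 0 <= 4 * B * G / eps.
  by rewrite divr_ge0 ?(ltW e0) // mulr_ge0 // mulr_ge0.
have [N LN] : exists N : nat, L < N%:R.
  by exists (Num.bound L); rewrite archi_boundP // /L; lra.
have N0' : 0 < N%:R :> R by rewrite /L in LN; lra.
have N0 : (0 < N)%N by rewrite -(ltr0n R).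
have YN : Y <= N%:R by rewrite /L in LN; lra.
have YYN : Y ^+ 2 / N%:R <= eps / 2.
  rewrite ler_pdivrMr // -ler_pdivrMl ?divr_gt0 //.
  have -> : (eps / 2)^-1 * Y ^+ 2 = 2 * Y ^+ 2 / eps by field; rewrite gt_eqF.
  by rewrite /L in LN; lra.
have t0 : 0 <= B / N%:R by rewrite divr_ge0 // ltW.
have t1 : B / N%:R <= 1 / 2 by rewrite ler_pdivrMr //; rewrite /L in LN; lra.
have tG : 2 * (B / N%:R) * G <= eps / 2.
  have -> : 2 * (B / N%:R) * G = 2 * B * G / N%:R by field; rewrite gt_eqF.
  rewrite ler_pdivrMr // -ler_pdivrMl ?divr_gt0 //.
  have -> : (eps / 2)^-1 * (2 * B * G) = 4 * B * G / eps by field; rewrite gt_eqF.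
  by rewrite /L in LN; lra.
have chiE : (chi - 1) ^+ 2 / sigma ^+ 2 = alpha ^+ 2.
  by rewrite /chi; field; rewrite gt_eqF.
have chiC : 1 < chi%:C :> R[i] by rewrite ltcR.
have [|q sq qP] := @bernstein_approx _ (gauss_poly sigma mu N) chi%:C
    (expR (alpha ^+ 2 + B / N%:R))%:C m chiC.
  by move=> w wE; have := gauss_poly_ellipse mu s0 N0 (ltW chi1) wE; rewrite chiE.
exists q => // x x1; rewrite -/chi -/G.
rewrite -(subrKA (gauss_poly sigma mu N).[x%:C]) (le_trans (ler_normD _ _)) //.
have -> : G + eps = eps / 2 + (G + eps / 2) by field.
rewrite rmorphD lerD //.
  by rewrite (le_trans (gauss_poly_real s0 N0 YN x1)) // lecR.
rewrite (le_trans (qP _ _)) //; first by rewrite !lecE /= oppr0 eqxx.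
have -> : 2 * (expR (alpha ^+ 2 + B / N%:R))%:C / ((chi%:C - 1) * chi%:C ^+ m) =
    (G * expR (B / N%:R))%:C.
  have asE : alpha * sigma = chi - 1 by rewrite /chi addrC addKr.
  rewrite /G asE expRD.
  rewrite !(rmorphM, fmorphV, rmorphXn, rmorphB, rmorph1, rmorph_nat) /=.
  by rewrite mulrA mulrAC.
rewrite lecR (@le_trans _ _ (G * (1 + 2 * (B / N%:R)))) //.
  by rewrite ler_wpM2l // expR_le_chord // t0.
by lra.
Qed.

End GaussApproximation.

(** * Entries of products with a diagonal matrix *)

Section Entries.
Variable R : realType.

(** The Cauchy-Schwarz inequality, normalised so that no square root occurs. *)
Lemma sum_mul_le (I : finType) (u v : I -> R) (t : R) : 0 <= t ->
  \sum_i u i ^+ 2 <= 1 -> \sum_i v i ^+ 2 <= t ^+ 2 -> \sum_i u i * v i <= t.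
Proof.
rewrite le_eqVlt => /predU1P[<- _|t0 u1 vt].
  rewrite expr0n /= => v0.
  have vi0 i : v i = 0.
    apply/eqP; rewrite -sqrf_eq0 eq_le sqr_ge0 andbT.
    rewrite (le_trans _ v0) // (bigD1 i) //= lerDl.
    by apply: sumr_ge0 => k _; apply: sqr_ge0.
  by rewrite big1 // => i _; rewrite vi0 mulr0.
rewrite -(ler_pM2l (_ : 0 < 2 * t)) ?mulr_gt0 // mulr_sumr.
rewrite (@le_trans _ _ (\sum_i (t ^+ 2 * u i ^+ 2 + v i ^+ 2))) //.
  apply: ler_sum => i _; have := sqr_ge0 (t * u i - v i).
  by rewrite !expr2; lra.
rewrite big_split /= -mulr_sumr.
have : t ^+ 2 * (\sum_i u i ^+ 2) <= t ^+ 2 * 1 by rewrite ler_wpM2l ?sqr_ge0.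
by move: vt; rewrite !expr2; lra.
Qed.

Lemma normc_norm (z : R[i]) : `|z| = (Normc.normc z)%:C.
Proof. by []. Qed.

Lemma normc_ge0 (z : R[i]) : 0 <= Normc.normc z.
Proof. by rewrite -ler0c -normc_norm. Qed.

Definition row_norm_sq n p (Y : 'M[R[i]]_(n, p)) i : R :=
  \sum_a Normc.normc (Y i a) ^+ 2.

Lemma row_norm_sqE n p (Y : 'M[R[i]]_(n, p)) i :
  (row_norm_sq Y i)%:C = (Y *m Y^t*) i i.
Proof.
rewrite mxE rmorph_sum; apply: eq_bigr => a _ /=.
by rewrite !mxE rmorphXn /= -normc_norm normCK.
Qed.

Lemma row_norm_sq1 n p (Y : 'M[R[i]]_(n, p)) i :
  (Y *m Y^t*) i i = 1 -> row_norm_sq Y i <= 1.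
Proof. by rewrite -row_norm_sqE => -[->]. Qed.

Lemma norm_sum_mul_le p (x y : 'I_p -> R[i]) (t : R) : 0 <= t ->
  \sum_a Normc.normc (x a) ^+ 2 <= 1 ->
  \sum_a Normc.normc (y a) ^+ 2 <= t ^+ 2 ->
  `|\sum_a x a * y a| <= t%:C.
Proof.
move=> t0 x1 yt; rewrite (le_trans (ler_norm_sum _ _ _)) //.
under eq_bigr do rewrite normrM !normc_norm -rmorphM.
by rewrite -rmorph_sum lecR sum_mul_le.
Qed.

Lemma mul_diag_adjoint n p (Y : 'M[R[i]]_(n, p)) (F : 'rV[R[i]]_p) i j :
  (Y *m diag_mx F *m Y^t*) i j = \sum_a Y i a * (F 0 a * (Y j a)^*).
Proof.
by rewrite mxE; apply: eq_bigr => a _; rewrite mul_mx_diag !mxE mulrA.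
Qed.

(** Cauchy-Schwarz for the rows [i] and [j] of [Y].  The matrix [Y] may be
    rectangular, so that this covers both the eigenvectors of the full matrix
    and the local ones. *)
Lemma entry_diag_perturb n p (Y : 'M[R[i]]_(n, p)) (F G : 'rV[R[i]]_p) (e : R) i j :
  0 <= e -> row_norm_sq Y i <= 1 -> row_norm_sq Y j <= 1 ->
  (forall a, `|F 0 a - G 0 a| <= e%:C) ->
  `|(Y *m diag_mx F *m Y^t*) i j - (Y *m diag_mx G *m Y^t*) i j| <= e%:C.
Proof.
move=> e0 Yi Yj FG; rewrite !mul_diag_adjoint -sumrB.
under eq_bigr do rewrite -mulrBr -mulrBl.
apply: norm_sum_mul_le => //.
rewrite (@le_trans _ _ (\sum_a e ^+ 2 * Normc.normc (Y j a) ^+ 2)) //.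
  apply: ler_sum => a _; rewrite -exprMn lerXn2r ?nnegrE ?mulr_ge0 ?normc_ge0 //.
  rewrite -lecR -normc_norm normrM norm_conjC rmorphM ler_wpM2r //.
by rewrite -mulr_sumr ler_piMr ?sqr_ge0.
Qed.

End Entries.

(** * Polynomials and functions of Hermitian matrices *)

Section MatrixPolynomials.
Variable R : realType.

(** Unlike [horner_mx], this makes sense for matrices of size 0. *)
Definition mx_poly n (q : {poly R[i]}) (A : 'M[R[i]]_n) : 'M[R[i]]_n :=
  \sum_(k < size q) q`_k *: A ^+ k.

Lemma mx_poly_intertwine n p (q : {poly R[i]}) (A : 'M[R[i]]_n)
    (Y : 'M[R[i]]_(n, p)) (d : 'rV[R]_p) :
  A *m Y = Y *m real_diag d ->
  mx_poly q A *m Y = Y *m diag_mx (map_mx (fun x => q.[x%:C]) d).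
Proof.
move=> AY; rewrite mulmx_suml.
have powY k : A ^+ k *m Y = Y *m diag_mx (map_mx (fun x => x%:C ^+ k) d).
  elim: k => [|k IHk].
    rewrite expr0 mul1mx mul_mx_diag; apply/matrixP => i a.
    by rewrite !mxE expr0 mulr1.
  rewrite exprSr -mulmxA AY mulmxA IHk !mul_mx_diag; apply/matrixP => i a.
  by rewrite !mxE -mulrA exprSr.
apply/matrixP => i a; rewrite mul_mx_diag summxE !mxE horner_coef mulr_sumr.
apply: eq_bigr => k _; rewrite -scalemxAl powY mul_mx_diag !mxE.
by rewrite mulrCA.
Qed.

Lemma hermitian_spectral n (A : 'M[R[i]]_n) : A \is hermsymmx ->
  exists (Y : 'M[R[i]]_n) (d : 'rV[R]_n),
    [/\ Y *m Y^t* = 1%:M, Y^t* *m Y = 1%:M, A *m Y = Y *m real_diag d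
      & forall f, hermitian_fun f A = Y *m real_diag (map_mx f d) *m Y^t*].
Proof.
move=> Ah; have /hermitian_normalmx/orthomx_spectralP AE := Ah.
have Pu := spectral_unitarymx A; have dr := hermitian_spectral_diag_real Ah.
pose P := spectralmx A.
have PP : P *m P^t* = 1%:M by apply/unitarymxP.
have PP' : P^t* *m P = 1%:M by apply: mulmx1C.
exists (P^t* ), (map_mx (@complex.Re R) (spectral_diag A)).
have dE : diag_mx (spectral_diag A) =
    real_diag (map_mx (@complex.Re R) (spectral_diag A)).
  congr diag_mx; apply/matrixP => i j; rewrite !mxE RRe_real //.
  by move/mxOverP: dr.
have fE f : diag_mx (map_mx (fun z => (f (complex.Re z))%:C) (spectral_diag A)) =
    real_diag (map_mx f (map_mx (@complex.Re R) (spectral_diag A))).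
  by rewrite /real_diag -!map_mx_comp.
rewrite trmxCK; split; first exact: PP'.
- exact: PP.
- by rewrite -dE [in LHS]AE (invmx_unitary Pu) -/P -!mulmxA PP mulmx1.
- move=> f; rewrite /hermitian_fun fE -/P (invmx_unitary Pu); exact: erefl.
Qed.

Lemma real_diag_hermitian p (d : 'rV[R]_p) : real_diag d \is hermsymmx.
Proof.
apply/is_hermitianmxP; rewrite expr0 scale1r; apply/matrixP => i j.
rewrite !mxE eq_sym; case: eqVneq => [->|_]; last by rewrite !mulr0n conjC0.
by rewrite !mulr1n conj_Creal // complex_real.
Qed.

(** The spectral decomposition of a diagonal matrix need not be the trivial one,
    but its eigenvectors can only mix coordinates with equal diagonal
    entries. *)
Lemma hermitian_fun_real_diag (f : R -> R) p (d : 'rV[R]_p) :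
  hermitian_fun f (real_diag d) = real_diag (map_mx f d).
Proof.
have [Y [l [YY _ dY ->]]] := hermitian_spectral (real_diag_hermitian d).
have -> : Y *m real_diag (map_mx f l) = real_diag (map_mx f d) *m Y.
  apply/matrixP => i a; rewrite mul_mx_diag mul_diag_mx !mxE.
  move/matrixP/(_ i a): dY; rewrite mul_mx_diag mul_diag_mx !mxE mulrC.
  have [->|Yia /(mulfI Yia) /complexI ->] := eqVneq (Y i a) 0.
    by move=> _; rewrite mul0r mulr0.
  by rewrite mulrC.
by rewrite -mulmxA YY mulmx1.
Qed.

(** Eigenvectors act from the left in [eigenvalue], so the witness is a row of
    the adjoint of [Y]. *)
Lemma unitary_diag_eigenvalue n (A Y : 'M[R[i]]_n) (d : 'rV[R]_n) a :
  Y *m Y^t* = 1%:M -> A *m Y = Y *m real_diag d -> eigenvalue A (d 0 a)%:C.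
Proof.
move=> YY AY; have YY' := mulmx1C YY.
apply/eigenvalueP; exists (row a (Y^t* )).
  rewrite -row_mul.
  have -> : Y^t* *m A = real_diag d *m Y^t*.
    by rewrite -[A]mulmx1 -YY mulmxA AY !mulmxA YY' mul1mx.
  by apply/rowP => j; rewrite mul_diag_mx !mxE.
apply/eqP => Ya0; have := congr1 (fun Z : 'M[R[i]]_n => Z a a) YY'.
rewrite mxE [RHS]mxE eqxx big1 => [/eqP|j _]; first by rewrite eq_sym oner_eq0.
by have /rowP/(_ j) := Ya0; rewrite !mxE => ->; rewrite mul0r.
Qed.

Lemma real_complex_bounds (x : R) : -1 < x%:C < 1 -> -1 <= x <= 1.
Proof.
by rewrite !ltcE /= oppr0 eqxx /= => /andP[/ltW -> /ltW ->].
Qed.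

End MatrixPolynomials.

(** * Walks, submatrices and local eigenvectors *)

Section Locality.
Variables (R : realType) (n : nat) (A : 'M[R[i]]_n) (m : nat) (E : {set 'I_n}).
Let Q := ext_element A m E.

Lemma pow_walk k i j : (A ^+ k) i j != 0 -> walk A i j k.
Proof.
elim: k i => [|k IHk] i.
  rewrite expr0 -[1]/(1%:M) mxE.
  case: (eqVneq i j) => [<- _|_]; last by rewrite eqxx.
  by apply/existsP; exists [tuple] => /=.
rewrite exprS mxE => /eqP sum0.
have [l /andP[Ail Alj]|no] := pickP (fun l => (A i l != 0) && ((A ^+ k) l j != 0)).
  have /existsP[p /andP[pp pl]] := IHk _ Alj.
  by apply/existsP; exists [tuple of l :: p]; rewrite /= [edge A i l]Ail pp.
case: sum0; apply: big1 => l _; have /negbT := no l.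
by rewrite negb_and !negbK => /orP[]/eqP->; rewrite ?mul0r ?mulr0.
Qed.

Lemma walk_ext_element k i j : j \in E -> (k <= m)%N -> walk A i j k -> i \in Q.
Proof.
move=> jE km ijk; rewrite inE; apply/exists_inP; exists j => //.
rewrite /gdist; case: pselect => [ex|[]]; last by exists k.
by rewrite lee_fin lez_nat; case: ex_minnP => l _ /(_ k ijk) /leq_trans; apply.
Qed.

Lemma pow_outside k i j : j \in E -> (k <= m)%N -> i \notin Q -> (A ^+ k) i j = 0.
Proof.
move=> jE km iQ; apply/eqP; apply: contraNT iQ => /pow_walk.
exact: walk_ext_element.
Qed.

(** Row [i] of the next power only involves entries (l, j) of the current one.
    These vanish for [l] outside [Q], and for [l] inside the two matrices
    agree at (i, l) when [i] is in [Q]; for [i] outside [Q] both sides are 0. *)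
Lemma pow_submx_on k i j : j \in E -> (k <= m)%N ->
  (submx_on A Q ^+ k) i j = (A ^+ k) i j.
Proof.
move=> jE; elim: k i => [|k IHk] i km; first by rewrite !expr0.
have [iQ|iQ] := boolP (i \in Q); last first.
  rewrite [RHS]pow_outside // exprS mxE big1 // => l _.
  by rewrite mxE (negbTE iQ) mul0r.
rewrite !exprS [LHS]mxE [RHS]mxE; apply: eq_bigr => l _.
rewrite IHk ?(ltnW km) // [submx_on _ _ _ _]mxE iQ /=.
by case: ifPn => // lQ; rewrite pow_outside ?mulr0 // ltnW.
Qed.

Lemma mx_poly_outside (q : {poly R[i]}) i j : (size q <= m.+1)%N ->
  j \in E -> i \notin Q -> mx_poly q A i j = 0.
Proof.
move=> sq jE iQ; rewrite summxE big1 // => k _; rewrite mxE pow_outside ?mulr0 //.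
by rewrite -ltnS (leq_trans (ltn_ord k)).
Qed.

Lemma mx_poly_submx_on (q : {poly R[i]}) i j : (size q <= m.+1)%N ->
  j \in E -> mx_poly q (submx_on A Q) i j = mx_poly q A i j.
Proof.
move=> sq jE; rewrite [LHS]summxE [RHS]summxE.
apply: eq_bigr => k _.
by rewrite [LHS]mxE [RHS]mxE pow_submx_on // -ltnS (leq_trans (ltn_ord k)).
Qed.

End Locality.

Section LocalEigen.
Variables (R : realType) (n : nat) (A : 'M[R[i]]_n) (Q : {set 'I_n}).
Variables (X : 'M[R[i]]_(n, #|Q|)) (d : 'rV[R]_#|Q|).
Hypothesis XP : local_eigen A X d.

(** The nonzero rows of [X] form a square matrix, for which a left inverse is a
    right inverse. *)
Lemma local_eigen_rows_unitary : rows_on Q X *m (rows_on Q X)^t* = 1%:M.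
Proof.
have [_ XX X0] := XP; apply: mulmx1C; rewrite -{}XX; apply/matrixP => a b.
rewrite !mxE [RHS](bigID (mem Q)) /= [X in _ = _ + X]big1 => [|i iQ].
  by rewrite addr0 [RHS]big_enum_val; apply: eq_bigr => i _; rewrite !mxE.
by rewrite !mxE !X0 // mulr0.
Qed.

Lemma local_eigen_projector i j : i \in Q -> j \in Q ->
  (X *m X^t*) i j = (i == j)%:R.
Proof.
move=> iQ jQ; have /matrixP := local_eigen_rows_unitary.
move=> /(_ (enum_rank_in iQ i) (enum_rank_in iQ j)).
rewrite !mxE -(inj_eq enum_val_inj) !enum_rankK_in // => <-.
by apply: eq_bigr => a _; rewrite !mxE !enum_rankK_in.
Qed.

Lemma local_eigen_row_norm i : i \in Q -> row_norm_sq X i <= 1.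
Proof. by move=> iQ; rewrite row_norm_sq1 // local_eigen_projector // eqxx. Qed.

(** The product of [X] and its adjoint is the coordinate projector on [Q], so
    multiplying by it does not change the columns with index in [Q]. *)
Lemma mx_poly_local_eigen (q : {poly R[i]}) i j : i \in Q -> j \in Q ->
  mx_poly q (submx_on A Q) i j =
  (X *m diag_mx (map_mx (fun x => q.[x%:C]) d) *m X^t*) i j.
Proof.
move=> iQ jQ; have [AX _ X0] := XP.
rewrite -(mx_poly_intertwine q AX) -mulmxA mxE (bigD1 j) //=.
rewrite local_eigen_projector // eqxx mulr1 big1 ?addr0 // => l lj.
have [lQ|lQ] := boolP (l \in Q).
  by rewrite local_eigen_projector // (negbTE lj) mulr0.
by rewrite mxE big1 ?mulr0 // => a _; rewrite X0 // mul0r.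
Qed.

Lemma submx_on_compress : X^t* *m submx_on A Q *m X = X^t* *m A *m X.
Proof.
have [_ _ X0] := XP; apply/matrixP => a b; rewrite !mxE.
apply: eq_bigr => j _; have [jQ|jQ] := boolP (j \in Q); last by rewrite X0 ?mulr0.
congr (_ * _); rewrite !mxE; apply: eq_bigr => i _; rewrite !mxE jQ andbT.
by case: ifPn => // iQ; rewrite X0 // conjC0 !mul0r.
Qed.

(** The local eigenvalue [d 0 a] is the Rayleigh quotient of [A] at the unit
    vector [col a X], hence a weighted mean of the eigenvalues [l] of [A]. *)
Lemma local_eigenvalue_bound a : A \is hermsymmx ->
  (forall z : R[i], eigenvalue A z -> -1 < z < 1) -> -1 <= d 0 a <= 1.
Proof.
move=> Ah Aspec; have [AX XX _] := XP.
have [Y [l [YY YY' AY _]]] := hermitian_spectral Ah.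
pose W := X^t* *m Y.
have WW : W *m W^t* = 1%:M.
  rewrite /W trmx_mul map_mxM trmxCK mulmxA -[_ *m Y *m _]mulmxA YY mulmx1.
  exact: XX.
have dE : real_diag d = W *m real_diag l *m W^t*.
  rewrite /W -[X^t* *m Y *m _]mulmxA -AY trmx_mul map_mxM trmxCK.
  rewrite !mulmxA -[_ *m Y *m _]mulmxA YY mulmx1 -submx_on_compress -mulmxA AX.
  by rewrite mulmxA XX mul1mx.
have Wa : row_norm_sq W a <= 1 by rewrite row_norm_sq1 // WW mxE eqxx.
(* Comparing with the zero diagonal turns the perturbation bound into a bound
   on the entry (a, a) itself. *)
have := @entry_diag_perturb _ _ _ W (map_mx (fun x => x%:C) l) 0 1 a a ler01 Wa Wa.
rewrite -[diag_mx _]/(real_diag l) -dE linear0 mulmx0 mul0mx !mxE eqxx subr0.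
rewrite norm_real_complex lecR ler_norml; apply => b; rewrite !mxE subr0.
rewrite norm_real_complex lecR ler_norml; apply: real_complex_bounds.
exact/Aspec/(unitary_diag_eigenvalue _ YY AY).
Qed.

End LocalEigen.

Section LocalError.
Variable R : realType.

(** Column [b] of [B] is the image of a unit vector, so its norm is at most the
    2-norm of [B].  Since the latter is a supremum, it must first be checked
    that [B] is bounded on the unit ball. *)
Lemma spectral_norm_entry p q (B : 'M[R[i]]_(p, q)) (x : 'I_p -> R[i]) b :
  \sum_a Normc.normc (x a) ^+ 2 <= 1 -> `|\sum_a x a * B a b| <= (mx_norm2 B)%:C.
Proof.
move=> x1; have ubB : has_ubound
    [set vec_norm2 (B *m y) |
      y in [set y : 'cV[R[i]]_q | vec_norm2 y <= 1]]%classic.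
  exists (Num.sqrt (\sum_(i < p) (\sum_(j < q) Normc.normc (B i j)) ^+ 2)).
  move=> _ [y /= y1 <-]; apply: ler_wsqrtr; apply: ler_sum => i _.
  rewrite lerXn2r ?nnegrE ?normc_ge0 ?sumr_ge0 // => [j _|]; first exact: normc_ge0.
  rewrite -lecR -normc_norm mxE (le_trans (ler_norm_sum _ _ _)) //.
  rewrite rmorph_sum ler_sum // => j _; rewrite normrM /= ler_piMr //.
  rewrite normc_norm (_ : 1 = 1%:C) // lecR -(@expr_le1 _ 2) ?normc_ge0 //.
  have y2 : \sum_(k < q) Normc.normc (y k 0) ^+ 2 <= 1.
    by rewrite -ler_sqrt // sqrtr1.
  rewrite (le_trans _ y2) // (bigD1 j) //= lerDl sumr_ge0 // => k _.
  exact: sqr_ge0.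
pose v : 'cV[R[i]]_q := delta_mx b 0.
have vB : vec_norm2 (B *m v) <= mx_norm2 B.
  apply: ub_le_sup => //; exists v => //=.
  rewrite /vec_norm2 (bigD1 b) //= big1 => [|k kb].
    by rewrite mxE !eqxx Normc.normc1 expr1n addr0 sqrtr1.
  by rewrite mxE (negbTE kb) Normc.normc0 expr0n.
have BvE a : (B *m v) a 0 = B a b by rewrite -colE mxE.
have B0 : 0 <= mx_norm2 B by rewrite (le_trans _ vB) // sqrtr_ge0.
apply: norm_sum_mul_le => //.
under eq_bigr do rewrite -BvE.
rewrite -(@sqr_sqrtr _ (\sum_a _)) ?sumr_ge0 // => [|a _]; last exact: sqr_ge0.
by rewrite lerXn2r ?nnegrE ?sqrtr_ge0.
Qed.

End LocalError.

(** * Error of a single entry *)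

Section EntryErrors.
Variables (R : realType) (n : nat) (A : 'M[R[i]]_n).
Hypothesis Ah : A \is hermsymmx.
Hypothesis Aspec : forall z : R[i], eigenvalue A z -> -1 < z < 1.
Variables (f : R -> R) (q : {poly R[i]}) (e : R).
Hypothesis e0 : 0 <= e.
Hypothesis fq : forall x, -1 <= x <= 1 -> `|(f x)%:C - q.[x%:C]| <= e%:C.

Lemma hermitian_fun_mx_poly i j :
  `|hermitian_fun f A i j - mx_poly q A i j| <= e%:C.
Proof.
have [Y [l [YY YY' AY ->]]] := hermitian_spectral Ah.
have Yrow k : row_norm_sq Y k <= 1 by rewrite row_norm_sq1 // YY mxE eqxx.
rewrite -[mx_poly q A]mulmx1 -YY mulmxA (mx_poly_intertwine q AY).
apply: entry_diag_perturb => // a; rewrite !mxE; apply/fq/real_complex_bounds.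
exact/Aspec/(unitary_diag_eigenvalue _ YY AY).
Qed.

Lemma local_fun_mx_poly (Q : {set 'I_n}) (X : 'M[R[i]]_(n, #|Q|))
    (d : 'rV[R]_#|Q|) i j :
  local_eigen A X d -> i \in Q -> j \in Q ->
  `|(X *m real_diag (map_mx f d) *m X^t*) i j - mx_poly q (submx_on A Q) i j|
    <= e%:C.
Proof.
move=> XP iQ jQ; rewrite (mx_poly_local_eigen XP) //.
apply: entry_diag_perturb => //; try exact: (local_eigen_row_norm XP).
by move=> a; rewrite !mxE; apply/fq/(local_eigenvalue_bound XP).
Qed.

Lemma entry_outside_error m (E : {set 'I_n}) i j : (size q <= m.+1)%N ->
  j \in E -> i \notin ext_element A m E -> `|hermitian_fun f A i j| <= e%:C.
Proof.
move=> sq jE iQ; have := hermitian_fun_mx_poly i j.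
by rewrite (mx_poly_outside sq jE iQ) subr0.
Qed.

(** [q] is exact when passing from [A] to the submatrix, so the error is that of
    replacing [f] by [q] once for each of the two matrices. *)
Lemma entry_inside_error m (E : {set 'I_n})
    (X : 'M[R[i]]_(n, #|ext_element A m E|)) (d : 'rV[R]_#|ext_element A m E|) i j :
  (size q <= m.+1)%N -> local_eigen A X d ->
  j \in E -> i \in ext_element A m E -> j \in ext_element A m E ->
  `|hermitian_fun f A i j - (X *m real_diag (map_mx f d) *m X^t*) i j|
    <= (2 * e)%:C.
Proof.
move=> sq XP jE iQ jQ; rewrite -(subrKA (mx_poly q A i j)).
rewrite (le_trans (ler_normD _ _)) // mulr_natl mulr2n rmorphD lerD //.
  exact: hermitian_fun_mx_poly.
rewrite -(mx_poly_submx_on _ i sq jE) distrC.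
exact: local_fun_mx_poly.
Qed.

End EntryErrors.

Section Truncation.
Variables (R : realType) (n : nat) (A : 'M[R[i]]_n) (Q : {set 'I_n}).

(** The error is an entry of [X *m B], where [B] is the residual of the singular
    value decomposition and row [i] of [X] has norm at most 1. *)
Lemma truncated_entry_error (X : 'M[R[i]]_(n, #|Q|)) (d : 'rV[R]_#|Q|)
    (f : R -> R) (tau : R) (r : nat)
    (Ut : 'M[R[i]]_(#|Q|, r)) (s : 'rV[R]_r) (Vt : 'M[R[i]]_(#|Q|, r)) i j :
  local_eigen A X d ->
  truncated_svd tau (hermitian_fun f (real_diag d) *m (rows_on Q X)^t*) Ut s Vt ->
  i \in Q -> j \in Q ->
  `|(X *m real_diag (map_mx f d) *m X^t*) i j -
    (row i (X *m Ut) *m col_on (real_diag s *m Vt^t*) j) 0 0| <= tau%:C.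
Proof.
rewrite hermitian_fun_real_diag => XP [_ _ _ svdP] iQ jQ.
rewrite /col_on; case: {-}_ / idP => // jQ'; set b := enum_rank_in jQ' j.
set B := _ - _ in svdP.
have -> : (X *m real_diag (map_mx f d) *m X^t*) i j -
    (row i (X *m Ut) *m col b (real_diag s *m Vt^t*)) 0 0 = (X *m B) i b.
  rewrite /B mulmxBr [RHS]mxE [X in _ = _ + X]mxE; congr (_ - _).
    rewrite -mulmxA mxE [RHS]mxE; apply: eq_bigr => a _.
    by rewrite !mul_diag_mx !mxE enum_rankK_in.
  have -> : X *m (Ut *m real_diag s *m Vt^t*) = X *m Ut *m (real_diag s *m Vt^t*).
    by rewrite !mulmxA.
  rewrite mxE [RHS]mxE; apply: eq_bigr => a _.
  by rewrite [row _ _ _ _]mxE [col _ _ _ _]mxE.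
rewrite mxE (le_trans (spectral_norm_entry _ _ _)) ?lecR //.
exact: (local_eigen_row_norm XP iQ).
Qed.

End Truncation.

Lemma mx_norm_le (K : numDomainType) m n (B : 'M[K]_(m, n)) (c : K) :
  0 <= c -> (forall i j, `|B i j| <= c) -> mx_norm B <= c.
Proof.
move=> c0 Bc; have [->//|/mx_norm_neq0[[i j] ->]] := eqVneq (mx_norm B) 0.
exact: Bc.
Qed.

Theorem theorem3p4 (R : realType) (n : nat) (A : 'M[R[i]]_n)
    (sigma mu alpha tau : R) (m M : nat) (E : 'I_M -> {set 'I_n})
    (X : forall k : 'I_M, 'M[R[i]]_(n, #|ext_element A m (E k)|))
    (d : forall k : 'I_M, 'rV[R]_#|ext_element A m (E k)|)
    (r : 'I_M -> nat)
    (Ut : forall k : 'I_M, 'M[R[i]]_(#|ext_element A m (E k)|, r k))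
    (s : forall k : 'I_M, 'rV[R]_(r k))
    (Vt : forall k : 'I_M, 'M[R[i]]_(#|ext_element A m (E k)|, r k)) :
  A \is hermsymmx ->
  (forall a : R[i], eigenvalue A a -> -1 < a < 1) ->
  0 < sigma -> 0 < alpha -> 0 <= tau -> (1 <= m)%N ->
  (forall k l : 'I_M, k != l -> [disjoint E k & E l]) ->
  (\bigcup_(k < M) E k)%SET = [set: 'I_n]%SET ->
  (forall k : 'I_M, local_eigen A (X k) (d k)) ->
  (forall k : 'I_M,
    truncated_svd tau
      (hermitian_fun (gauss sigma mu) (real_diag (d k))
         *m (rows_on (ext_element A m (E k)) (X k))^t*)
      (Ut k) (s k) (Vt k)) ->
  let rho := (1 + alpha * sigma)^-1 in
  let K := 2 / (rho * alpha * sigma) * expR (alpha ^+ 2) in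
  let U := fun k : 'I_M => X k *m Ut k in
  let V := fun k : 'I_M => real_diag (s k) *m (Vt k)^t* in
  let ft := assemble E U V in
  mx_norm (hermitian_fun (gauss sigma mu) A - ft)
    <= (2 * K * rho `^ (m%:R / 2 + 1) + tau)%:C.
Proof.
move=> Ah Aspec s0 a0 tau0 _ _ Ecover XP svdP.
pose rho := (1 + alpha * sigma)^-1.
pose K := 2 / (rho * alpha * sigma) * expR (alpha ^+ 2).
pose ft := assemble E (fun k => X k *m Ut k)
                      (fun k => real_diag (s k) *m (Vt k)^t*).
rewrite /= -/rho -/K -/ft.
have as0 : 0 < alpha * sigma by rewrite mulr_gt0.
have chi0 : 0 < 1 + alpha * sigma by rewrite addr_gt0.
have rho0 : 0 < rho by rewrite invr_gt0.
have rho1 : rho <= 1 by rewrite invf_le1 // lerDl ltW.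
have K0 : 0 <= K by rewrite mulr_ge0 ?expR_ge0 // divr_ge0 // -mulrA mulr_ge0 ?ltW.
pose delta := 2 * expR (alpha ^+ 2) / (alpha * sigma * (1 + alpha * sigma) ^+ m).
have deltaE : delta = K * rho ^+ m.+1.
  rewrite /delta /K (exprS rho) /rho exprVn; field.
  by rewrite !gt_eqF ?exprn_gt0.
have delta0 : 0 <= delta by rewrite deltaE mulr_ge0 // exprn_ge0 // ltW.
have delta_le : delta <= K * rho `^ (m%:R / 2 + 1).
  rewrite deltaE ler_wpM2l // -powR_mulrn ?(ltW rho0) // ger_powR ?rho0 //.
  rewrite -[m.+1%:R]natr1 lerD2r ler_pdivrMr //.
  by rewrite ler_peMr // ler1n.
have entry i j :
    `|(hermitian_fun (gauss sigma mu) A - ft) i j| <= (2 * delta + tau)%:C.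
  rewrite normc_norm lecR; apply/ler_addgt0Pr => eps eps0.
  rewrite -lecR -normc_norm.
  have eps2 : 0 < eps / 2 by rewrite divr_gt0.
  have [q sq qP] := gauss_approx mu m s0 a0 eps2; rewrite -/delta in qP.
  have d0 : 0 <= delta + eps / 2 by rewrite addr_ge0 // ltW.
  rewrite [_ i j]mxE [X in _ + X]mxE [ft i j]mxE.
  case: pickP => [k /andP[iQ jE]|no].
    have jQ : j \in ext_element A m (E k).
      (* An element lies in its extension through the walk of length 0. *)
      apply: (walk_ext_element jE (leq0n m)).
      by apply/existsP; exists [tuple] => /=.
    rewrite -(subrKA ((X k *m real_diag (map_mx (gauss sigma mu) (d k))
      *m (X k)^t*) i j)).
    rewrite (le_trans (ler_normD _ _)) //.
    have -> : 2 * delta + tau + eps = 2 * (delta + eps / 2) + tau by field.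
    rewrite rmorphD lerD //.
      exact: (entry_inside_error Ah Aspec d0 qP sq (XP k)).
    exact: (truncated_entry_error (XP k) (svdP k)).
  have : j \in (\bigcup_(k < M) E k)%SET by rewrite Ecover inE.
  case/bigcupP => k _ jE; have iQ : i \notin ext_element A m (E k).
    by have /negbT := no k; rewrite jE andbT.
  rewrite subr0 (le_trans (entry_outside_error Ah Aspec d0 qP sq jE iQ)) // lecR.
  by lra.
apply: mx_norm_le => [|i j].
  by rewrite ler0c addr_ge0 // mulr_ge0 ?powR_ge0 // mulr_ge0.
by rewrite (le_trans (entry i j)) // lecR lerD2r -mulrA ler_wpM2l.
Qed.
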